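(* Let $ABC$ be an anticlockwise oriented triangle and let a circle $\Gamma$ with centre $O$ meet the sides $BC$, $CA$, $AB$ at $\{A_1,A_2\}$, $\{B_1,B_2\}$, $\{C_1,C_2\}$ respectively. Let $P$ and $Q$ be the Miquel points of $\triangle A_1B_1C_1$ and $\triangle A_2B_2C_2$ in $\triangle ABC$, respectively, and put $T_A=PA_1\cap QA_2$, $T_B=PB_1\cap QB_2$, $T_C=PC_1\cap QC_2$. Let $R$ be the pole with respect to $\Gamma$ of the line through the (collinear) points $A_0=B_1C_2\cap C_1B_2$, $B_0=A_1C_2\cap C_1A_2$, $C_0=A_1B_2\cap B_1A_2$. Let $S_t$ be the point of $\odot(ABC)$ at which the parallels through $A,B,C$ to $T_BT_C,T_CT_A,T_AT_B$ respectively are concurrent, and let $T_a$ be the antipode of $S_t$ in $\odot(ABC)$. Then the figures $\triangle ABC\cup S_t\cup T_a$ and $\triangle T_AT_BT_C\cup R\cup O$ are oppositely similar; that is, there is an orientation-reversing similarity of the plane mapping $A,B,C,S_t,T_a$ to $T_A,T_B,T_C,R,O$ respectively.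
   Context: All objects lie in the Euclidean plane; $\odot(XYZ)$ denotes the circumcircle of $\triangle XYZ$. The two labels on each side may be assigned in either order. The antipode of a point on a circle is the diametrically opposite point. Miquel point: if $D,E,F$ lie on the lines $BC,CA,AB$ respectively, the Miquel point of $\triangle DEF$ in $\triangle ABC$ is the common point of $\odot(AEF)$, $\odot(BFD)$, $\odot(CDE)$. The points $A_0,B_0,C_0$ (intersections taken in the projective plane) are collinear by Pascal's theorem. The three parallels defining $S_t$ are indeed concurrent at a point of $\odot(ABC)$. Coincidences are read in the limiting sense: if two points $X=Y$ of $\Gamma$ coincide, $XY$ means the tangent to $\Gamma$ at $X$; if, e.g., $B_1=A\neq C_1$, then $\odot(AB_1C_1)$ means the circle through $A$ and $C_1$ tangent to line $CA$ at $A$ (and similarly in the other cases). The configuration is assumed nondegenerate, so that every named object exists and is uniquely determined: no circle above has all three of its defining points equal, $P\neq Q$, $P\notin\{A_1,B_1,C_1\}$, $Q\notin\{A_2,B_2,C_2\}$, the pairs of lines defining $T_A,T_B,T_C$ are distinct and not parallel, and the line $A_0B_0C_0$ is a line of the Euclidean plane not passing through $O$. *)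

(* Defs.v *)
From Stdlib Require Import Reals.
From Coquelicot Require Import Coquelicot.
Open Scope R_scope.

(* The Euclidean plane is the complex plane with the distance |X - Y|. *)
Definition point : Type := Complex.C.

Definition edist (X Y : point) : R := Cmod (X - Y)%C.

Definition dot (u v : point) : R := fst u * fst v + snd u * snd v.

Definition orient (X Y Z : point) : R :=
  fst (Y - X)%C * snd (Z - X)%C - snd (Y - X)%C * fst (Z - X)%C.

Definition anticlockwise (X Y Z : point) : Prop := 0 < orient X Y Z.

(* Homogeneous coordinates.  Nonzero triples up to [same_hom] represent the
   points of the real projective plane, and also its lines: (a, b, c) is the
   line a x + b y + c w = 0. *)
Definition hcoord : Type := (R * R * R)%type.

Definition hzero : hcoord := (0, 0, 0).

Definition same_hom (p q : hcoord) : Prop :=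
  let '(p1, p2, p3) := p in
  exists k : R, k <> 0 /\ q = (k * p1, k * p2, k * p3).

Definition incident (p l : hcoord) : Prop :=
  let '(x, y, w) := p in
  let '(a, b, c) := l in
  a * x + b * y + c * w = 0.

Definition hom (X : point) : hcoord := (fst X, snd X, 1).

Definition on_line (X : point) (l : hcoord) : Prop := incident (hom X) l.

(* Neither hzero nor the line at infinity. *)
Definition euclidean_line (l : hcoord) : Prop :=
  let '(a, b, _) := l in ~ (a = 0 /\ b = 0).

(* For Euclidean lines: parallel or equal. *)
Definition parallel_or_eq (l m : hcoord) : Prop :=
  let '(a, b, _) := l in
  let '(a', b', _) := m in
  a * b' = b * a'.

(* The line XY, for X <> Y: the cross product of hom X and hom Y. *)
Definition line_through (X Y : point) : hcoord :=
  (snd X - snd Y, fst Y - fst X, fst X * snd Y - snd X * fst Y).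

(* The parallel through A to the line XY, for X <> Y. *)
Definition parallel_line (A X Y : point) : hcoord :=
  line_through A (A + (Y - X))%C.

(* p is the unique common point, in the projective plane, of the lines l, m. *)
Definition is_meet (p l m : hcoord) : Prop :=
  ~ same_hom l m /\ p <> hzero /\ incident p l /\ incident p m.

(* l is the line through the collinear projective points p, q, r, which are
   not all equal. *)
Definition is_common_line (l p q r : hcoord) : Prop :=
  ~ (same_hom p q /\ same_hom q r) /\
  l <> hzero /\ incident p l /\ incident q l /\ incident r l.

(* X is the intersection of the nonparallel Euclidean lines l and m. *)
Definition is_intersection (X : point) (l m : hcoord) : Prop :=
  ~ parallel_or_eq l m /\ on_line X l /\ on_line X m.

Record circle : Type := Circle {
  center : point;
  radius : R;
  radius_pos : 0 < radius
}.

Definition on_circle (X : point) (K : circle) : Prop :=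
  edist X (center K) = radius K.

Definition is_circumcircle (K : circle) (A B C : point) : Prop :=
  on_circle A K /\ on_circle B K /\ on_circle C K.

Definition antipode (K : circle) (X : point) : point := (2 * center K - X)%C.

(* The tangent to K at a point X of K: the perpendicular at X to the radius. *)
Definition tangent_line (K : circle) (X : point) : hcoord :=
  let n := (X - center K)%C in (fst n, snd n, - dot n X).

(* The line XY for points X, Y of K, read as the tangent when X = Y. *)
Definition chord (K : circle) (X Y : point) : hcoord :=
  if Ceq_dec X Y then tangent_line K X else line_through X Y.

(* The line BC meets K at {X1, X2}; X1 = X2 means that it is tangent to K. *)
Definition meets_line_at (K : circle) (B C X1 X2 : point) : Prop :=
  forall X : point,
    on_circle X K /\ on_line X (line_through B C) <-> X = X1 \/ X = X2.

(* K is the circle (AEF), for E on the line CA and F on the line AB.  If E = A,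
   then K is tangent to CA at A; if F = A, then K is tangent to AB at A. *)
Definition is_corner_circle (K : circle) (A B C E F : point) : Prop :=
  ~ (E = A /\ F = A) /\
  on_circle A K /\ on_circle E K /\ on_circle F K /\
  (E = A -> on_line C (tangent_line K A)) /\
  (F = A -> on_line B (tangent_line K A)).

(* P is the Miquel point of DEF in ABC. *)
Definition is_miquel_point (P A B C D E F : point) : Prop :=
  on_line D (line_through B C) /\
  on_line E (line_through C A) /\
  on_line F (line_through A B) /\
  exists KA KB KC : circle,
    is_corner_circle KA A B C E F /\
    is_corner_circle KB B C A F D /\
    is_corner_circle KC C A B D E /\
    on_circle P KA /\ on_circle P KB /\ on_circle P KC.

(* R is the pole of the Euclidean line l with respect to K: l is the line
   (X - O) . (R - O) = r^2, where O and r are the center and radius of K. *)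
Definition is_pole (R : point) (K : circle) (l : hcoord) : Prop :=
  forall X : point,
    on_line X l <->
    dot (X - center K)%C (R - center K)%C = radius K ^ 2.

Definition similarity (f : point -> point) : Prop :=
  exists k : R, 0 < k /\
    forall X Y : point, edist (f X) (f Y) = k * edist X Y.

Definition orientation_reversing (f : point -> point) : Prop :=
  forall X Y Z : point, anticlockwise X Y Z -> anticlockwise (f X) (f Z) (f Y).

(* Main.v *)
(* In the frame where Gamma is the unit circle, let s_a = a1 a2, s_b = b1 b2,
   s_c = c1 c2; a vector d is parallel to BC iff d = - s_a conj d.  The Miquel
   property makes the lines P A1, P B1, P C1 meet the sides at equal angles, that
   is, P - A1 = l s_a conj (P - A1) with a common l of modulus 1; the system for Q
   is equivalent to the one for P, with inverse factor.  It follows that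
     (1 - l) T_A = a1 - l a2 = s_a conj q - l q,
   and cyclically, so T_A, T_B, T_C lie on a circle through O, and r = - 2 l q /
   (1 - l) is the antipode of O there.  The polar of r is a linear combination of
   the chords b1 c2 and c1 b2, so it passes through A_0, and likewise through B_0
   and C_0; hence r is R.  The map z |-> T_A + m conj (z - A) sending B to T_B
   sends C to T_C, and the circumcentre to r / 2; it sends S_t to r because its
   image lies on the parallels through T_A to BC and through T_B to CA. *)
Require Import Defs.
From Stdlib Require Import Reals Lra Psatz Classical.
From Coquelicot Require Import Coquelicot.
Local Open Scope C_scope.

(** * Equations between complex numbers and their conjugates *)

Lemma Ceq_coord (u v : C) : fst u = fst v -> snd u = snd v -> u = v.
Proof. intros E F. now apply injective_projections. Qed.

Lemma RtoC_conj (r : R) : Cconj (RtoC r) = RtoC r.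
Proof. apply Ceq_coord; simpl; ring. Qed.

(** Serves [lincomb]: a goal follows once [ring] finds that the difference of its sides equals that
    of a combination of hypotheses, assembled with [Ceq_add] and [Ceq_scale]. *)
Lemma Ceq_minus (a b x y : C) : a = b -> x - y = a - b -> x = y.
Proof.
  intros -> E. replace x with (x - y + y) by ring. rewrite E. ring.
Qed.

Lemma Ceq_add (a b c d : C) : a = b -> c = d -> a + c = b + d.
Proof. now intros -> ->. Qed.

Lemma Ceq_scale (k a b : C) : a = b -> k * a = k * b.
Proof. now intros ->. Qed.

Ltac conj_push :=
  repeat rewrite ?Cplus_conj, ?Cminus_conj, ?Cmult_conj, ?Copp_conj, ?Cconj_conj.

Ltac lincomb H := refine (Ceq_minus _ _ _ _ H _); ring.

Ltac conj_of H :=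
  let E := fresh H "c" in
  pose proof (f_equal Cconj H) as E; revert E; conj_push; intro E.

Lemma Ceq_minus_0 (x y : C) : x - y = 0 -> x = y.
Proof. intro E. lincomb E. Qed.

Lemma Cmult_cancel (k x y : C) : k <> 0 -> k * x = k * y -> x = y.
Proof.
  intros k0 E. replace x with (/ k * (k * x)) by now field.
  rewrite E. now field.
Qed.

Lemma Cminus_neq_0 (x y : C) : x <> y -> x - y <> 0.
Proof. intros n E. now apply n, Ceq_minus_0. Qed.

Lemma Cconj_neq_0 (x : C) : x <> 0 -> Cconj x <> 0.
Proof.
  intros x0 E. apply x0. rewrite <- (Cconj_conj x), E.
  apply RtoC_conj.
Qed.

Lemma Cmult_eq_0 (x y : C) : x * y = 0 -> x = 0 \/ y = 0.
Proof.
  intro E. destruct (Ceq_dec x 0) as [H | H]; [now left | right].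
  apply (Cmult_cancel x); [easy | rewrite E; ring].
Qed.

Lemma unit_neq_0 (a : C) : a * Cconj a = 1 -> a <> 0.
Proof.
  intros ua ->. apply C1_nz. rewrite <- ua. ring.
Qed.

(** * Directions of lines, encoded by [along] *)

(* On the unit circle, the chord with endpoints a and b has the direction of
   the vectors d with [along (a * b) d]. *)
Definition along (s d : C) : Prop := d = - s * Cconj d.

Lemma along_opp (s d : C) : along s d -> along s (- d).
Proof.
  unfold along. intro E. conj_push. lincomb (Ceq_scale (- (1)) _ _ E).
Qed.

Lemma along_add (s d e : C) : along s d -> along s e -> along s (d + e).
Proof.
  unfold along. intros D E. conj_push. lincomb (Ceq_add _ _ _ _ D E).
Qed.

(** A nonzero d determines its factor as - d / conj d. *)
Lemma along_unique (s t d : C) : d <> 0 -> along s d -> along t d -> s = t.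
Proof.
  unfold along. intros d0 S T. apply (Cmult_cancel (Cconj d)).
  - now apply Cconj_neq_0.
  - lincomb (Ceq_add _ _ _ _ S (Ceq_scale (- (1)) _ _ T)).
Qed.

Lemma along_both_0 (s t d : C) : s <> t -> along s d -> along t d -> d = 0.
Proof.
  intros st S T. destruct (Ceq_dec d 0) as [H | H]; [easy |].
  exfalso. now apply st, (along_unique s t d).
Qed.

(** For l = 1 this is the chord equation x + a b conj x = a + b; a factor l of modulus 1 turns the
    chord about a. *)
Lemma along_chord (l a b x : C) :
  a * Cconj a = 1 -> along (l * (a * b)) (x - a) ->
  x + l * (a * b) * Cconj x = a + l * b.
Proof.
  unfold along. intros ua E. revert E. conj_push. intro E.
  lincomb (Ceq_add _ _ _ _ E (Ceq_scale (l * b) _ _ ua)).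
Qed.

(** * Uniqueness of the Miquel angle *)

(** Divided differences eliminate [k0] and then [k1]. *)
Lemma quadratic_three_roots (k0 k1 k2 x y z : C) :
  x <> y -> y <> z -> z <> x ->
  k0 + k1 * x + k2 * (x * x) = 0 ->
  k0 + k1 * y + k2 * (y * y) = 0 ->
  k0 + k1 * z + k2 * (z * z) = 0 ->
  k0 = 0 /\ k1 = 0 /\ k2 = 0.
Proof.
  intros xy yz zx X Y Z.
  assert (XY : k1 + k2 * (x + y) = 0).
  { apply (Cmult_cancel (x - y)); [now apply Cminus_neq_0 |].
    lincomb (Ceq_add _ _ _ _ X (Ceq_scale (- (1)) _ _ Y)). }
  assert (YZ : k1 + k2 * (y + z) = 0).
  { apply (Cmult_cancel (y - z)); [now apply Cminus_neq_0 |].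
    lincomb (Ceq_add _ _ _ _ Y (Ceq_scale (- (1)) _ _ Z)). }
  assert (K2 : k2 = 0).
  { apply (Cmult_cancel (z - x)); [now apply Cminus_neq_0 |].
    lincomb (Ceq_add _ _ _ _ YZ (Ceq_scale (- (1)) _ _ XY)). }
  rewrite K2 in XY, X.
  assert (K1 : k1 = 0) by lincomb XY.
  rewrite K1 in X. repeat split; [lincomb X | easy | easy].
Qed.

(* If l <> l', then subtracting the two systems gives a2 = al + be s, and hence
   a1 = al' + be' s, on the three sides, where s = a1 a2.  The quadratic
   s = (al + be s) (al' + be' s) has three roots, hence it is an identity, and
   a1 or a2 is constant. *)
Lemma miquel_angle_unique (a1 a2 b1 b2 c1 c2 x y l x' y' l' : C) :
  a1 * a2 <> b1 * b2 -> b1 * b2 <> c1 * c2 -> c1 * c2 <> a1 * a2 ->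
  ~ (a1 = b1 /\ b1 = c1) -> ~ (a2 = b2 /\ b2 = c2) ->
  x + a1 * a2 * y = a1 - l * a2 ->
  x + b1 * b2 * y = b1 - l * b2 ->
  x + c1 * c2 * y = c1 - l * c2 ->
  x' + a1 * a2 * y' = a1 - l' * a2 ->
  x' + b1 * b2 * y' = b1 - l' * b2 ->
  x' + c1 * c2 * y' = c1 - l' * c2 ->
  l = l'.
Proof.
  intros ab bc ca n1 n2 A B D A' B' D'.
  destruct (Ceq_dec l l') as [H | H]; [easy | exfalso].
  set (al := - (x - x') / (l - l')).
  set (be := - (y - y') / (l - l')).
  pose proof (Cminus_neq_0 _ _ H) as H0.
  assert (second : forall u v : C, x + u * v * y = u - l * v ->
    x' + u * v * y' = u - l' * v -> v = al + be * (u * v)).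
  { intros u v E E'. apply (Cmult_cancel (l - l')); [easy |].
    replace ((l - l') * (al + be * (u * v)))
      with (- (x - x') + - (y - y') * (u * v)) by (unfold al, be; now field).
    lincomb (Ceq_add _ _ _ _ E (Ceq_scale (- (1)) _ _ E')). }
  pose proof (second a1 a2 A A') as A2.
  pose proof (second b1 b2 B B') as B2.
  pose proof (second c1 c2 D D') as D2.
  set (al' := x + l * al). set (be' := y + l * be).
  assert (first : forall u v : C, x + u * v * y = u - l * v ->
    v = al + be * (u * v) -> u = al' + be' * (u * v)).
  { intros u v E V. unfold al', be'.
    lincomb (Ceq_add _ _ _ _ (Ceq_scale (- (1)) _ _ E) (Ceq_scale l _ _ V)). }
  pose proof (first a1 a2 A A2) as A1.
  pose proof (first b1 b2 B B2) as B1.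
  pose proof (first c1 c2 D D2) as D1.
  assert (quad : forall u v : C, u = al' + be' * (u * v) ->
    v = al + be * (u * v) ->
    al' * al + (al' * be + be' * al - 1) * (u * v)
      + be' * be * (u * v * (u * v)) = 0).
  { intros u v U V.
    replace (al' * al + (al' * be + be' * al - 1) * (u * v)
      + be' * be * (u * v * (u * v)))
      with ((al' + be' * (u * v)) * (al + be * (u * v)) - u * v) by ring.
    rewrite <- U, <- V. ring. }
  destruct (quadratic_three_roots _ _ _ _ _ _ ab bc ca (quad _ _ A1 A2)
    (quad _ _ B1 B2) (quad _ _ D1 D2)) as [K0 [K1 K2]].
  assert (cst : be' = 0 \/ be = 0) by now apply Cmult_eq_0.
  destruct cst as [Z | Z].
  - apply n1. rewrite Z in A1, B1, D1.
    split; [transitivity al' | transitivity al']; lincomb A1 || lincomb B1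
      || lincomb D1 || (symmetry; (lincomb B1 || lincomb D1)).
  - apply n2. rewrite Z in A2, B2, D2.
    split; [transitivity al | transitivity al]; lincomb A2 || lincomb B2
      || lincomb D2 || (symmetry; (lincomb B2 || lincomb D2)).
Qed.

(** * The Pascal line and the pole in the frame of the unit circle *)

(* The line [q' x - l q x' = (1 - l) w] is a linear combination of the chords
   b1 c2 and c1 b2. *)
Lemma pascal_polar (b1 b2 c1 c2 l q q' x x' w : C) :
  b1 * b2 <> c1 * c2 ->
  b1 * b2 * q' - l * q = b1 - l * b2 ->
  c1 * c2 * q' - l * q = c1 - l * c2 ->
  x + b1 * c2 * x' = w * (b1 + c2) ->
  x + c1 * b2 * x' = w * (c1 + b2) ->
  x * q' - l * q * x' = w * (1 - l).
Proof.
  intros bc B D X Y.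
  apply (Cmult_cancel (b1 * b2 - c1 * c2)); [now apply Cminus_neq_0 |].
  (* These weights of [B] and [D] leave only (b1 b2 - c1 c2) (x q' - l q x') on the left; their
     right side is then the left side of the combination of the chords with coefficients - (c1 + l
     b2) and b1 + l c2. *)
  refine (Ceq_minus _ _ _ _ (Ceq_add _ _ _ _
    (Ceq_add _ _ _ _ (Ceq_scale (- (c1 + l * b2)) _ _ X)
      (Ceq_scale (b1 + l * c2) _ _ Y))
    (Ceq_add _ _ _ _
      (Ceq_scale (x - c1 * c2 * x') _ _ B)
      (Ceq_scale (b1 * b2 * x' - x) _ _ D))) _).
  ring.
Qed.

Lemma Cdistinct_1_minus (l : C) : l <> 1 -> 1 - l <> 0.
Proof. intro n. apply Cminus_neq_0. congruence. Qed.

(** As conj l = 1 / l, conjugation multiplies 1 - l by - 1 / l. *)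
Lemma conj_1_minus (l : C) : l * Cconj l = 1 -> l * Cconj (1 - l) = l - 1.
Proof.
  intro ul. conj_push. rewrite RtoC_conj.
  lincomb (Ceq_scale (- (1)) _ _ ul).
Qed.

(** The numerator l q + s conj q of t - r is fixed by conjugation followed by multiplication by l s,
    because l and s have modulus 1. Hence the line from T_A to R is parallel to BC, and similarly
    for the other vertices. *)
Lemma polar_along (l q r s t : C) :
  l * Cconj l = 1 -> l <> 1 -> s * Cconj s = 1 ->
  (1 - l) * t = s * Cconj q - l * q ->
  (1 - l) * r = - (l * q + l * q) ->
  along s (r - t).
Proof.
  intros ul l1 us T P. unfold along.
  pose proof (conj_1_minus l ul) as L.
  apply (Cmult_cancel (1 - l)); [now apply Cdistinct_1_minus |].
  assert (E : (1 - l) * (r - t) = - (l * q + s * Cconj q)).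
  { lincomb (Ceq_add _ _ _ _ P (Ceq_scale (- (1)) _ _ T)). }
  pose proof (f_equal Cconj E) as E'. revert E'.
  rewrite Cmult_conj. conj_push. intro E'.
  apply (f_equal (Cmult (s * l))) in E'.
  rewrite E. conj_push.
  assert (L' : l * Cconj (1 - l) * (Cconj r - Cconj t)
    = (l - 1) * (Cconj r - Cconj t)) by now rewrite L.
  assert (ul' : l * Cconj l * (s * Cconj q) = s * Cconj q) by (rewrite ul; ring).
  assert (us' : s * Cconj s * (l * q) = l * q) by (rewrite us; ring).
  revert L' E'. conj_push. intros L' E'.
  refine (Ceq_minus _ _ _ _ (Ceq_add _ _ _ _
    (Ceq_add _ _ _ _ (Ceq_scale s _ _ L') (Ceq_scale (- (1)) _ _ E'))
    (Ceq_add _ _ _ _ ul' us')) _).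
  ring.
Qed.

(** * The opposite similarity in the frame of the unit circle *)

(** The map z |-> m conj z is |m| times a reflection, so applying it twice preserves directions: if
    u is parallel to the image of d, then the image of u is parallel to d. *)
Lemma parallel_along (m d s u : C) :
  d <> 0 -> along s d ->
  u * Cconj (m * Cconj d) = Cconj u * (m * Cconj d) ->
  along s (m * Cconj u).
Proof.
  unfold along. conj_push. intros d0 S E.
  apply (Cmult_cancel (Cconj d)); [now apply Cconj_neq_0 |].
  assert (S' : u * Cconj m * d = u * Cconj m * (- s * Cconj d)) by now rewrite <- S.
  lincomb (Ceq_add _ _ _ _ (Ceq_scale (- (1)) _ _ E) S').
Qed.

(** Both k and k' lie on the perpendicular bisector of ab; the factor - s encodes the direction
    perpendicular to that of s. *)
Lemma equidistant_along (a b k k' s : C) :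
  a <> b -> along s (b - a) ->
  (k - a) * Cconj (k - a) = (k - b) * Cconj (k - b) ->
  (k' - a) * Cconj (k' - a) = (k' - b) * Cconj (k' - b) ->
  along (- s) (k' - k).
Proof.
  unfold along. conj_push. intros ab S E E'.
  apply (Cmult_cancel (Cconj (b - a))).
  { apply Cconj_neq_0, Cminus_neq_0. congruence. }
  conj_push.
  assert (S' : (Cconj k' - Cconj k) * (b - a)
    = (Cconj k' - Cconj k) * (- s * (Cconj b - Cconj a))) by now rewrite <- S.
  refine (Ceq_minus _ _ _ _ (Ceq_add _ _ _ _
    (Ceq_add _ _ _ _ E' (Ceq_scale (- (1)) _ _ E))
    (Ceq_scale (- (1)) _ _ S')) _).
  ring.
Qed.

(** Here O is the origin, k is the circumcentre of abc and k + k - st is the antipode of S_t. *)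
Lemma opposite_similarity (a b c sa sb sc l q ta tb tc r st k : C) :
  sa * Cconj sa = 1 -> sb * Cconj sb = 1 -> sc * Cconj sc = 1 ->
  sa <> sb -> sb <> sc -> sc <> sa ->
  a <> b -> b <> c -> c <> a ->
  along sa (c - b) -> along sb (a - c) -> along sc (b - a) ->
  l * Cconj l = 1 -> l <> 1 ->
  (1 - l) * ta = sa * Cconj q - l * q ->
  (1 - l) * tb = sb * Cconj q - l * q ->
  (1 - l) * tc = sc * Cconj q - l * q ->
  (1 - l) * r = - (l * q + l * q) ->
  ta <> tb ->
  (k - a) * Cconj (k - a) = (k - b) * Cconj (k - b) ->
  (k - b) * Cconj (k - b) = (k - c) * Cconj (k - c) ->
  (st - a) * Cconj (tc - tb) = Cconj (st - a) * (tc - tb) ->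
  (st - b) * Cconj (ta - tc) = Cconj (st - b) * (ta - tc) ->
  exists m : C, m <> 0 /\
    tb = ta + m * Cconj (b - a) /\ tc = ta + m * Cconj (c - a) /\
    r = ta + m * Cconj (st - a) /\ ta + m * Cconj (k + k - st - a) = 0.
Proof.
  intros ua ub uc sab sbc sca ab bc ca Da Db Dc ul l1 Ta Tb Tc P tab Kab Kbc Sa Sb.
  assert (ba0 : b - a <> 0) by (apply Cminus_neq_0; congruence).
  assert (cb0 : c - b <> 0) by (apply Cminus_neq_0; congruence).
  assert (ac0 : a - c <> 0) by (apply Cminus_neq_0; congruence).
  pose proof (Cdistinct_1_minus l l1) as L0.
  pose proof (Cconj_neq_0 _ ba0) as ba0'.
  set (m := (tb - ta) / Cconj (b - a)).
  assert (Mb : tb = ta + m * Cconj (b - a)).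
  { unfold m. now field. }
  assert (m0 : m <> 0).
  { intro E. apply tab. rewrite Mb, E. ring. }
  (* Differences of the T points are differences of [sa], [sb], [sc] times the common factor conj q
     / (1 - l), so the claim reduces to the sum of the three side equations, whose left side
     vanishes. *)
  assert (Mc : tc = ta + m * Cconj (c - a)).
  { apply (Cmult_cancel (1 - l)); [easy |].
    apply (Cmult_cancel (Cconj (b - a))); [easy |].
    transitivity ((1 - l) * ta * Cconj (b - a)
      + ((1 - l) * tb - (1 - l) * ta) * Cconj (c - a)).
    2: { unfold m. now field. }
    replace (Cconj (b - a) * ((1 - l) * tc)) with ((1 - l) * tc * Cconj (b - a))
      by ring.
    rewrite Ta, Tb, Tc.
    unfold along in *. revert Da Db Dc. conj_push. intros Da Db Dc.
    refine (Ceq_minus _ _ _ _ (Ceq_scale (Cconj q) _ _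
      (Ceq_add _ _ _ _ Da (Ceq_add _ _ _ _ Db Dc))) _). ring. }
  assert (Ra : r = ta + m * Cconj (st - a)).
  { set (y := ta + m * Cconj (st - a)).
    (* The line from A to S_t is parallel to T_B T_C, the image of BC, so its own image is parallel
       to BC. *)
    assert (Ya : along sa (y - ta)).
    { replace (y - ta) with (m * Cconj (st - a)) by (unfold y; ring).
      apply (parallel_along m (c - b)); [easy | easy |].
      replace (m * Cconj (c - b)) with (tc - tb); [easy |].
      rewrite Mb, Mc. conj_push. ring. }
    assert (Yb : along sb (y - tb)).
    { replace (y - tb) with (m * Cconj (st - b)).
      2: { unfold y. rewrite Mb. conj_push. ring. }
      apply (parallel_along m (a - c)); [easy | easy |].
      replace (m * Cconj (a - c)) with (ta - tc); [easy |].
      rewrite Mc. conj_push. ring. }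
    apply Ceq_minus_0, (along_both_0 sa sb); [easy | |].
    - replace (r - y) with ((r - ta) + - (y - ta)) by ring.
      apply along_add; [now apply (polar_along l q) | now apply along_opp].
    - replace (r - y) with ((r - tb) + - (y - tb)) by ring.
      apply along_add; [now apply (polar_along l q) | now apply along_opp]. }
  exists m. repeat split; [easy | easy | easy | easy |].
  (* The circumcentre [g] of the triangle ta tb tc is the midpoint of 0 and r. *)
  set (g := - (l * q) / (1 - l)).
  (* The preimage of [g]; it turns out to be equidistant from a, b, c and so equal to [k]. *)
  set (k' := a + Cconj ((g - ta) / m)).
  assert (G : r = g + g).
  { apply (Cmult_cancel (1 - l)); [easy |]. rewrite P. unfold g. now field. }
  assert (Ga : m * Cconj (k' - a) = g - ta).
  { unfold k'. replace (a + Cconj ((g - ta) / m) - a) with (Cconj ((g - ta) / m)) by ring.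
    rewrite Cconj_conj. now field. }
  assert (Gb : m * Cconj (k' - b) = g - tb).
  { rewrite Mb. revert Ga. conj_push. intro Ga. lincomb Ga. }
  assert (Gc : m * Cconj (k' - c) = g - tc).
  { rewrite Mc. revert Ga. conj_push. intro Ga. lincomb Ga. }
  (* At every vertex, (1 - l) (g - t) = - s conj q has modulus |q|. *)
  assert (norm : forall x s t : C, s * Cconj s = 1 ->
    (1 - l) * t = s * Cconj q - l * q -> m * Cconj (k' - x) = g - t ->
    (1 - l) * m * Cconj ((1 - l) * m) * ((k' - x) * Cconj (k' - x))
      = q * Cconj q).
  { intros x s t us T X.
    assert (Y : (1 - l) * m * Cconj (k' - x) = - s * Cconj q).
    { rewrite <- Cmult_assoc, X.
      replace ((1 - l) * (g - t)) with (- (l * q) - (1 - l) * t).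
      2: { unfold g. now field. }
      rewrite T. ring. }
    transitivity ((1 - l) * m * Cconj (k' - x) * Cconj ((1 - l) * m * Cconj (k' - x))).
    - conj_push. ring.
    - rewrite Y. conj_push. lincomb (Ceq_scale (q * Cconj q) _ _ us). }
  assert (lm0 : (1 - l) * m * Cconj ((1 - l) * m) <> 0).
  { apply Cmult_neq_0; [| apply Cconj_neq_0]; now apply Cmult_neq_0. }
  assert (KK : k' - k = 0).
  { apply (along_both_0 (- sc) (- sa)).
    - intro E. apply sca. lincomb (Ceq_scale (- (1)) _ _ E).
    - apply (equidistant_along a b); [easy | easy | easy |].
      apply (Cmult_cancel _ _ _ lm0).
      now rewrite (norm a sa ta ua Ta Ga), (norm b sb tb ub Tb Gb).
    - apply (equidistant_along b c); [easy | easy | easy |].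
      apply (Cmult_cancel _ _ _ lm0).
      now rewrite (norm c sc tc uc Tc Gc), (norm b sb tb ub Tb Gb). }
  (* The antipode of S_t goes to g + g - r = 0. *)
  apply Ceq_minus_0 in KK. rewrite <- KK.
  revert Ra Ga. rewrite G. conj_push. intros Ra Ga.
  lincomb (Ceq_add _ _ _ _ Ra (Ceq_add _ _ _ _ Ga Ga)).
Qed.

(** * Passage between real coordinates and complex equations *)

Lemma cross_real (u v : C) :
  u * Cconj v = Cconj u * v <-> (fst u * snd v - snd u * fst v = 0)%R.
Proof.
  destruct u as [u1 u2], v as [v1 v2]; split; simpl.
  - intro E. apply (f_equal snd) in E. simpl in E. lra.
  - intro E. apply Ceq_coord; simpl; lra.
Qed.

Lemma dot_real (u v : C) :
  u * Cconj v + Cconj u * v = RtoC (2 * dot u v).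
Proof.
  destruct u as [u1 u2], v as [v1 v2]. unfold dot.
  apply Ceq_coord; simpl; ring.
Qed.

Lemma along_cross (s u v : C) : along s u -> along s v -> u * Cconj v = Cconj u * v.
Proof.
  unfold along. intros U V.
  lincomb (Ceq_add _ _ _ _ (Ceq_scale (Cconj v) _ _ U)
    (Ceq_scale (- Cconj u) _ _ V)).
Qed.

Lemma cross_along (s u v : C) :
  v <> 0 -> along s v -> u * Cconj v = Cconj u * v -> along s u.
Proof.
  unfold along. intros v0 V E.
  apply (Cmult_cancel (Cconj v)); [now apply Cconj_neq_0 |].
  lincomb (Ceq_add _ _ _ _ E (Ceq_scale (Cconj u) _ _ V)).
Qed.

Lemma along_scale (s d : C) (r : R) : r <> 0%R -> along s (r * d) <-> along s d.
Proof.
  intro r0. unfold along. conj_push.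
  rewrite !RtoC_conj.
  split; intro E.
  - apply (Cmult_cancel (RtoC r)).
    + intro Z. apply r0. now apply RtoC_inj.
    + lincomb E.
  - lincomb (Ceq_scale (RtoC r) _ _ E).
Qed.

Lemma along_unit (l s d : C) :
  d <> 0 -> s * Cconj s = 1 -> along (l * s) d -> l * Cconj l = 1.
Proof.
  unfold along. intros d0 us E. conj_of E.
  apply (Cmult_cancel d); [easy |].
  assert (us' : s * Cconj s * (l * Cconj l * d) = l * Cconj l * d)
    by (rewrite us; ring).
  refine (Ceq_minus _ _ _ _ (Ceq_add _ _ _ _ (Ceq_scale (- (1)) _ _ us')
    (Ceq_add _ _ _ _ (Ceq_scale (- (1)) _ _ E) (Ceq_scale (l * s) _ _ Ec))) _).
  ring.
Qed.

Lemma on_line_cross (X Y Z : point) :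
  on_line X (line_through Y Z) <->
  (X - Y) * Cconj (Z - Y) = Cconj (X - Y) * (Z - Y).
Proof.
  rewrite cross_real.
  destruct X as [x1 x2], Y as [y1 y2], Z as [z1 z2].
  unfold on_line, incident, hom, line_through; simpl. split; intro; lra.
Qed.

Lemma on_line_along (s : C) (X Y Z : point) :
  Y <> Z -> along s (Z - Y) ->
  on_line X (line_through Y Z) <-> along s (X - Y).
Proof.
  intros n D. rewrite on_line_cross. split.
  - apply cross_along; [apply Cminus_neq_0; congruence | easy].
  - intro E. now apply (along_cross s).
Qed.

Lemma parallel_of_along (s : C) (X Y Z W : point) :
  along s (X - Y) -> along s (Z - W) ->
  parallel_or_eq (line_through X Y) (line_through Z W).
Proof.
  intros U V. pose proof (along_cross _ _ _ U V) as E.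
  apply cross_real in E. revert E.
  destruct X as [x1 x2], Y as [y1 y2], Z as [z1 z2], W as [w1 w2].
  simpl. intro; lra.
Qed.

Lemma orient_along (s : C) (A B D : point) :
  along s (B - A) -> along s (D - A) -> orient A B D = 0%R.
Proof.
  intros U V. now apply cross_real, (along_cross s).
Qed.

(** * Circles, chords and tangents *)

Lemma Cmod_sqr (x : C) (r : R) :
  (0 < r)%R -> Cmod x = r <-> x * Cconj x = RtoC (r * r).
Proof.
  intro hr. rewrite <- Cmod2_conj. split.
  - intros ->. f_equal. ring.
  - intro E. apply RtoC_inj in E. pose proof (Cmod_ge_0 x). nra.
Qed.

Lemma on_circle_sqr (X : point) (K : circle) :
  on_circle X K <->
  (X - center K) * Cconj (X - center K) = RtoC (radius K * radius K).
Proof. apply Cmod_sqr, radius_pos. Qed.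

Lemma on_circle_unit (O : point) (r : R) (hr : (0 < r)%R) (x : C) :
  on_circle (O + r * x) (Circle O r hr) <-> x * Cconj x = 1.
Proof.
  rewrite on_circle_sqr. simpl.
  replace (O + r * x - O) with (r * x) by ring. conj_push.
  rewrite !RtoC_conj.
  rewrite RtoC_mult.
  assert (r0 : RtoC r <> 0) by (intro E; apply RtoC_inj in E; lra).
  split; intro E.
  - apply (Cmult_cancel (r * r)); [now apply Cmult_neq_0 | lincomb E].
  - lincomb (Ceq_scale (r * r) _ _ E).
Qed.

Lemma tangent_dot (K : circle) (X Y : point) :
  on_line Y (tangent_line K X) <-> dot (Y - X) (X - center K) = 0%R.
Proof.
  unfold on_line, tangent_line, incident, hom, dot.
  destruct X as [x1 x2], Y as [y1 y2], (center K) as [k1 k2]. simpl.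
  split; intro; lra.
Qed.

(** On this circle conj u = p / u and conj v = p / v. *)
Lemma circle_chord_along (u v p : C) :
  p <> 0 -> u * Cconj u = p -> v * Cconj v = p -> along (u * v / p) (v - u).
Proof.
  unfold along. intros p0 U V. conj_push. apply (Cmult_cancel p); [easy |].
  replace (p * (- (u * v / p) * (Cconj v - Cconj u)))
    with (- (u * (v * Cconj v)) + u * Cconj u * v) by now field.
  rewrite U, V. ring.
Qed.

(** * Inscribed angles and Miquel points *)

(* The limiting case E = A of a corner circle is the tangent-chord angle. *)
Lemma corner_chord (K : circle) (A D E P : point) (s : C) :
  A <> D -> along s (D - A) -> on_line E (line_through A D) ->
  on_circle A K -> on_circle E K -> on_circle P K ->
  (E = A -> on_line D (tangent_line K A)) ->
  along ((P - center K) / (A - center K) * s) (P - E).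
Proof.
  intros AD S EL HA HE HP tan.
  apply on_circle_sqr in HA, HE, HP.
  set (k := center K) in *. set (rho := RtoC (radius K * radius K)) in *.
  assert (rho0 : rho <> 0).
  { intro Z. apply RtoC_inj in Z. pose proof (radius_pos K). nra. }
  assert (a0 : A - k <> 0).
  { intro Z. apply rho0. rewrite <- HA, Z. ring. }
  (* The line AD is the chord AE, or the tangent at A if E = A. Replacing A by P in the factor of
     that chord multiplies it by (P - k) / (A - k). *)
  assert (Es : s = (A - k) * (E - k) / rho).
  { destruct (Ceq_dec E A) as [EA | EA].
    - apply (along_unique _ _ (D - A)); [apply Cminus_neq_0; congruence | easy |].
      pose proof (proj1 (tangent_dot _ _ _) (tan EA)) as T. fold k in T.
      pose proof (dot_real (D - A) (A - k)) as T'.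
      rewrite T, Rmult_0_r in T'.
      rewrite EA. unfold along. apply (Cmult_cancel rho); [easy |].
      replace (rho * (- ((A - k) * (A - k) / rho) * Cconj (D - A)))
        with (- ((A - k) * (A - k)) * Cconj (D - A)) by now field.
      rewrite <- HA. lincomb (Ceq_scale (A - k) _ _ T').
    - apply (along_unique _ _ (E - A)); [now apply Cminus_neq_0 | |].
      + now apply (on_line_along s E A D).
      + replace (E - A) with ((E - k) - (A - k)) by ring.
        now apply circle_chord_along. }
  replace ((P - k) / (A - k) * s) with ((E - k) * (P - k) / rho).
  2: { rewrite Es. now field. }
  replace (P - E) with ((P - k) - (E - k)) by ring.
  now apply circle_chord_along.
Qed.

Lemma on_line_sym (X Y Z : point) :
  on_line X (line_through Y Z) -> on_line X (line_through Z Y).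
Proof.
  destruct X as [x1 x2], Y as [y1 y2], Z as [z1 z2].
  unfold on_line, incident, hom, line_through; simpl. intro; lra.
Qed.

Lemma along_swap (s : C) (X Y : point) : along s (X - Y) -> along s (Y - X).
Proof.
  intro E. replace (Y - X) with (- (X - Y)) by ring. now apply along_opp.
Qed.

(** The factor l = (P - k) / (A - k), with k the centre of K, involves neither E nor F, so it serves
    both sides through A. *)
Lemma corner_circle_along (K : circle) (A B D E F P : point) (sb sc : C) :
  A <> B -> D <> A -> along sb (A - D) -> along sc (B - A) ->
  on_line E (line_through D A) -> on_line F (line_through A B) ->
  is_corner_circle K A B D E F -> on_circle P K ->
  exists l : C, along (l * sb) (P - E) /\ along (l * sc) (P - F).
Proof.
  intros AB DA Sb Sc EL FL (_ & HA & HE & HF & TE & TF) HP.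
  exists ((P - center K) / (A - center K)). split.
  - apply (corner_chord K A D); auto using on_line_sym, along_swap.
  - apply (corner_chord K A B); auto.
Qed.

(** The circle at A gives one factor for F and G, the circle at B one for G and E. They agree
    because P - G is nonzero and has both factors. *)
Lemma miquel_along (P A B D E F G : point) (sa sb sc : C) :
  A <> B -> B <> D -> D <> A ->
  along sa (D - B) -> along sb (A - D) -> along sc (B - A) ->
  sa <> 0 -> sb <> 0 -> sc <> 0 ->
  P <> E -> P <> F -> P <> G ->
  is_miquel_point P A B D E F G ->
  exists l : C,
    along (l * sa) (P - E) /\ along (l * sb) (P - F) /\ along (l * sc) (P - G).
Proof.
  intros AB BD DA Sa Sb Sc a0 b0 c0 PE PF PG
    (LE & LF & LG & KA & KB & KC & HA & HB & _ & PA & PB & _).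
  destruct (corner_circle_along KA A B D F G P sb sc) as (l & L1 & L2); auto.
  destruct (corner_circle_along KB B D A G E P sc sa) as (l' & L3 & L4); auto.
  assert (l = l').
  { apply (Cmult_cancel sc); [easy |].
    rewrite !(Cmult_comm sc).
    now apply (along_unique _ _ (P - G)); [apply Cminus_neq_0 | |]. }
  subst l'. now exists l.
Qed.

(** * Intersections of lines with Gamma, and its chords *)

(* The second intersection of the line with the circle is s times the conjugate
   of the first one; uniqueness of the intersections identifies it with a2. *)
Lemma meets_line_along (O : point) (r : R) (hr : (0 < r)%R) (Y Z : point) (a1 a2 : C) :
  Y <> Z -> meets_line_at (Circle O r hr) Y Z (O + r * a1) (O + r * a2) ->
  a1 * Cconj a1 = 1 /\ a2 * Cconj a2 = 1 /\ along (a1 * a2) (Z - Y).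
Proof.
  intros YZ M.
  assert (r0 : r <> 0%R) by lra.
  assert (r0' : RtoC r <> 0) by (intro E; apply RtoC_inj in E; lra).
  assert (inj : forall u v : C, O + r * u = O + r * v -> u = v).
  { intros u v E. apply (Cmult_cancel r); [easy | lincomb E]. }
  destruct (proj2 (M (O + r * a1)) (or_introl eq_refl)) as [U1 L1].
  destruct (proj2 (M (O + r * a2)) (or_intror eq_refl)) as [U2 L2].
  apply on_circle_unit in U1, U2.
  repeat split; [easy | easy |].
  assert (d0 : Z - Y <> 0) by (apply Cminus_neq_0; congruence).
  pose proof (Cconj_neq_0 _ d0) as d0'.
  set (s := - ((Z - Y) / Cconj (Z - Y))).
  assert (S : along s (Z - Y)) by (unfold along, s; now field).
  assert (us : s * Cconj s = 1).
  { unfold s. rewrite Copp_conj, Cdiv_conj by easy. rewrite Cconj_conj. now field. }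
  pose proof (unit_neq_0 _ U1) as a10.
  pose proof (proj1 (on_line_along s _ _ _ YZ S) L1) as D1.
  pose proof (proj1 (on_line_along s _ _ _ YZ S) L2) as D2.
  assert (D3 : along s (O + r * (s * Cconj a1) - Y)).
  { replace (O + r * (s * Cconj a1) - Y)
      with ((O + r * a1 - Y) + r * (s * Cconj a1 - a1)) by ring.
    apply along_add; [easy |]. apply along_scale; [easy |].
    unfold along. conj_push.
    lincomb (Ceq_scale a1 _ _ us). }
  assert (D12 : a2 <> a1 -> s = a1 * a2).
  { intro n. apply (along_unique _ _ (a2 - a1)); [now apply Cminus_neq_0 | |].
    - apply (along_scale s _ r r0).
      replace (r * (a2 - a1)) with ((O + r * a2 - Y) + - (O + r * a1 - Y)) by ring.
      now apply along_add; [| apply along_opp].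
    - replace (a1 * a2) with (a1 * a2 / 1) by field.
      apply circle_chord_along; auto using C1_nz. }
  assert (Ss : s = a1 * a2).
  { destruct (Ceq_dec a2 a1) as [E | n]; [| now apply D12].
    assert (I : O + r * (s * Cconj a1) = O + r * a1).
    { destruct (proj1 (M (O + r * (s * Cconj a1)))) as [I | I].
      - split.
        + apply on_circle_unit. conj_push.
          replace (s * Cconj a1 * (Cconj s * a1))
            with (s * Cconj s * (a1 * Cconj a1)) by ring.
          rewrite us, U1. ring.
        + exact (proj2 (on_line_along s _ _ _ YZ S) D3).
      - exact I.
      - rewrite I, E. reflexivity. }
    apply inj in I. rewrite E.
    lincomb (Ceq_add _ _ _ _ (Ceq_scale a1 _ _ I) (Ceq_scale (- s) _ _ U1)). }
  now rewrite <- Ss.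
Qed.

(** [X] is the homogeneous point shifted to the centre. The homogeneous chord equation also covers
    points at infinity, where w = 0, and the tangent, where b = c. *)
Lemma chord_incident (O : point) (r : R) (hr : (0 < r)%R) (b c : C) (x y w : R) :
  b * Cconj b = 1 -> c * Cconj c = 1 ->
  incident (x, y, w) (chord (Circle O r hr) (O + r * b) (O + r * c)) ->
  let X := (x, y) - w * O in
  X + b * c * Cconj X = RtoC (r * w) * (b + c).
Proof.
  intros ub uc I X.
  assert (r0' : RtoC r <> 0) by (intro E; apply RtoC_inj in E; lra).
  unfold chord in I. destruct (Ceq_dec (O + r * b) (O + r * c)) as [E | n].
  - assert (bc : b = c) by (apply (Cmult_cancel r); [easy | lincomb E]).
    subst c.
    pose proof (dot_real (X - RtoC (r * w) * b) b) as T.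
    replace (dot (X - RtoC (r * w) * b) b) with 0%R in T.
    + rewrite Rmult_0_r in T. revert T. conj_push. rewrite RtoC_conj. intro T.
      assert (ub' : b * Cconj b * (X - RtoC (r * w) * b) = X - RtoC (r * w) * b)
        by (rewrite ub; ring).
      assert (ub2 : b * Cconj b * (RtoC (r * w) * b) = RtoC (r * w) * b)
        by (rewrite ub; ring).
      refine (Ceq_minus _ _ _ _ (Ceq_add _ _ _ _ (Ceq_scale b _ _ T)
        (Ceq_add _ _ _ _ (Ceq_scale (- (1)) _ _ ub') ub2)) _). ring.
    + revert I. unfold X, dot, tangent_line, incident.
      destruct O as [o1 o2], b as [b1 b2]. unfold dot. simpl. intro I. nra.
  - assert (bc : b <> c) by (intros ->; now apply n).
    assert (T : (X - RtoC (r * w) * b) * Cconj (c - b)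
      = Cconj (X - RtoC (r * w) * b) * (c - b)).
    { apply cross_real. revert I. unfold X, line_through, incident.
      destruct O as [o1 o2], b as [b1 b2], c as [c1 c2]. simpl. intro I. nra. }
    assert (D : along (b * c) (c - b)).
    { replace (b * c) with (b * c / 1) by field.
      apply circle_chord_along; auto using C1_nz. }
    apply cross_along with (s := b * c) in T; [| | easy].
    2: { apply Cminus_neq_0. congruence. }
    unfold along in T. revert T. conj_push. rewrite RtoC_conj. intro T.
    lincomb (Ceq_add _ _ _ _ T (Ceq_scale (RtoC (r * w) * c) _ _ ub)).
Qed.

(** The hypotheses are the equations of the lines P A1 and Q A2. Eliminating conj t leaves (1 - l^2)
    t = (1 - l) (a1 + l a2). *)
Lemma apex_eq (l s a1 a2 t : C) :
  l <> 0 -> l <> 1 -> l <> - (1) -> s = a1 * a2 ->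
  t + l * s * Cconj t = a1 + l * a2 ->
  t + / l * s * Cconj t = a2 + / l * a1 ->
  (1 + l) * t = a1 + l * a2.
Proof.
  intros l0 l1 l2 -> E F.
  assert (F' : l * t + a1 * a2 * Cconj t = l * a2 + a1).
  { transitivity (l * (t + / l * (a1 * a2) * Cconj t)); [now field |].
    rewrite F. now field. }
  apply (Cmult_cancel (1 - l)); [now apply Cdistinct_1_minus |].
  lincomb (Ceq_add _ _ _ _ E (Ceq_scale (- l) _ _ F')).
Qed.

(** * The polar line and its incidence with the Pascal points *)

(* The line [(X - O) . rho = r], for rho in the frame where Gamma is the unit
   circle. *)
Definition polar (O : point) (r : R) (rho : C) : hcoord :=
  (fst rho, snd rho, (- (dot rho O + r))%R).

Lemma polar_neq_0 (O : point) (r : R) (rho : C) : (0 < r)%R -> polar O r rho <> hzero.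
Proof.
  destruct rho as [p1 p2]. intros hr E. injection E as -> -> E.
  unfold dot in E. simpl in E. lra.
Qed.

Lemma incident_polar (O : point) (r : R) (rho : C) (x y w : R) :
  incident (x, y, w) (polar O r rho) <->
  dot ((x, y) - w * O) rho = (r * w)%R.
Proof.
  destruct O as [o1 o2], rho as [p1 p2]. unfold polar, incident, dot. simpl.
  split; intro; lra.
Qed.

(** Multiplied by 1 - l, the doubled polar equation X conj rho + conj X rho = 2 r w is twice the
    identity of [pascal_polar]. *)
Lemma pascal_incident (O : point) (r : R) (hr : (0 < r)%R)
  (b1 b2 c1 c2 l q rho : C) (p : hcoord) :
  b1 * Cconj b1 = 1 -> b2 * Cconj b2 = 1 ->
  c1 * Cconj c1 = 1 -> c2 * Cconj c2 = 1 ->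
  l * Cconj l = 1 -> l <> 1 -> b1 * b2 <> c1 * c2 ->
  b1 * b2 * Cconj q - l * q = b1 - l * b2 ->
  c1 * c2 * Cconj q - l * q = c1 - l * c2 ->
  (1 - l) * rho = - (l * q + l * q) ->
  incident p (chord (Circle O r hr) (O + r * b1) (O + r * c2)) ->
  incident p (chord (Circle O r hr) (O + r * c1) (O + r * b2)) ->
  incident p (polar O r rho).
Proof.
  intros ub1 ub2 uc1 uc2 ul l1 bc B D P I J. destruct p as [[x y] w].
  apply chord_incident in I, J; try easy.
  apply incident_polar. set (X := (x, y) - w * O) in *.
  pose proof (pascal_polar b1 b2 c1 c2 l q (Cconj q) X (Cconj X) (RtoC (r * w))
    bc B D I J) as E.
  apply RtoC_inj. apply (Cmult_cancel (1 + 1)).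
  { rewrite <- RtoC_plus. intro Z. apply RtoC_inj in Z. lra. }
  replace ((1 + 1) * RtoC (dot X rho)) with (RtoC (2 * dot X rho)).
  2: { apply Ceq_coord; simpl; ring. }
  rewrite <- dot_real.
  apply (Cmult_cancel (1 - l)); [now apply Cdistinct_1_minus |].
  (* Conjugation of [P], using conj l = 1 / l. *)
  assert (P' : (1 - l) * Cconj rho = Cconj q + Cconj q).
  { pose proof (f_equal Cconj P) as Pc. revert Pc. rewrite Cmult_conj. intro Pc.
    apply (f_equal (Cmult l)) in Pc.
    rewrite Cmult_assoc, conj_1_minus in Pc by easy. revert Pc. conj_push. intro Pc.
    assert (ul' : l * Cconj l * (Cconj q + Cconj q) = Cconj q + Cconj q)
      by (rewrite ul; ring).
    lincomb (Ceq_add _ _ _ _ (Ceq_scale (- (1)) _ _ Pc) ul'). }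
  refine (Ceq_minus _ _ _ _ (Ceq_add _ _ _ _
    (Ceq_add _ _ _ _ (Ceq_scale X _ _ P') (Ceq_scale (Cconj X) _ _ P))
    (Ceq_scale (1 + 1) _ _ E)) _).
  ring.
Qed.

(** * Uniqueness of lines in the projective plane *)

(** The vector product, which represents the join of two distinct points or the meet of two distinct
    lines. *)
Definition cross (p q : hcoord) : hcoord :=
  let '(p1, p2, p3) := p in
  let '(q1, q2, q3) := q in
  ((p2 * q3 - p3 * q2)%R, (p3 * q1 - p1 * q3)%R, (p1 * q2 - p2 * q1)%R).

Lemma same_hom_sym (p q : hcoord) : same_hom p q -> same_hom q p.
Proof.
  destruct p as [[p1 p2] p3]. intros (k & k0 & ->). exists (/ k)%R.
  split; [now apply Rinv_neq_0_compat |].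
  repeat f_equal; now field.
Qed.

Lemma same_hom_trans (p q s : hcoord) :
  same_hom p q -> same_hom q s -> same_hom p s.
Proof.
  destruct p as [[p1 p2] p3]. intros (k & k0 & ->) (h & h0 & ->).
  exists (h * k)%R. split; [now apply Rmult_integral_contrapositive |].
  now rewrite !Rmult_assoc.
Qed.

Lemma cross_same_hom (p q : hcoord) :
  p <> hzero -> q <> hzero -> cross p q = hzero -> same_hom p q.
Proof.
  destruct p as [[p1 p2] p3], q as [[q1 q2] q3]. unfold hzero. simpl.
  intros p0 q0 E. injection E as E1 E2 E3.
  assert (scaled : forall k : R, q1 = (k * p1)%R -> q2 = (k * p2)%R ->
    q3 = (k * p3)%R ->
    exists k : R, k <> 0%R /\ (q1, q2, q3) = ((k * p1)%R, (k * p2)%R, (k * p3)%R)).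
  { intros k -> -> ->. exists k. split; [| easy].
    intros ->. apply q0. now rewrite !Rmult_0_l. }
  destruct (Req_dec p1 0) as [Z1 | n1].
  - destruct (Req_dec p2 0) as [Z2 | n2].
    + destruct (Req_dec p3 0) as [Z3 | n3].
      * exfalso. apply p0. now rewrite Z1, Z2, Z3.
      * apply (scaled (q3 / p3)%R); apply (Rmult_eq_reg_l p3); try easy;
          field_simplify; try easy; lra.
    + apply (scaled (q2 / p2)%R); apply (Rmult_eq_reg_l p2); try easy;
        field_simplify; try easy; lra.
  - apply (scaled (q1 / p1)%R); apply (Rmult_eq_reg_l p1); try easy;
      field_simplify; try easy; lra.
Qed.

(** The identity p x (l x m) = (p . m) l - (p . l) m. *)
Lemma cross_incident (p l m : hcoord) :
  incident p l -> incident p m -> cross p (cross l m) = hzero.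
Proof.
  destruct p as [[p1 p2] p3], l as [[l1 l2] l3], m as [[m1 m2] m3].
  unfold incident, hzero. simpl. intros L M.
  repeat f_equal.
  - replace (p2 * (l1 * m2 - l2 * m1) - p3 * (l3 * m1 - l1 * m3))%R with
      (l1 * (m1 * p1 + m2 * p2 + m3 * p3) - m1 * (l1 * p1 + l2 * p2 + l3 * p3))%R
      by ring. rewrite L, M. ring.
  - replace (p3 * (l2 * m3 - l3 * m2) - p1 * (l1 * m2 - l2 * m1))%R with
      (l2 * (m1 * p1 + m2 * p2 + m3 * p3) - m2 * (l1 * p1 + l2 * p2 + l3 * p3))%R
      by ring. rewrite L, M. ring.
  - replace (p1 * (l3 * m1 - l1 * m3) - p2 * (l2 * m3 - l3 * m2))%R with
      (l3 * (m1 * p1 + m2 * p2 + m3 * p3) - m3 * (l1 * p1 + l2 * p2 + l3 * p3))%R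
      by ring. rewrite L, M. ring.
Qed.

(** If l x m were nonzero, it would represent both p and q. *)
Lemma line_unique (p q l m : hcoord) :
  p <> hzero -> q <> hzero -> ~ same_hom p q -> l <> hzero -> m <> hzero ->
  incident p l -> incident q l -> incident p m -> incident q m -> same_hom l m.
Proof.
  intros p0 q0 pq l0 m0 pl ql pm qm.
  destruct (classic (cross l m = hzero)) as [Z | n].
  - now apply cross_same_hom.
  - exfalso. apply pq, (same_hom_trans _ (cross l m)).
    + apply cross_same_hom; auto using cross_incident.
    + apply same_hom_sym, cross_same_hom; auto using cross_incident.
Qed.

Lemma common_line_unique (p q s l m : hcoord) :
  p <> hzero -> q <> hzero -> s <> hzero -> is_common_line l p q s ->
  m <> hzero -> incident p m -> incident q m -> incident s m -> same_hom l m.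
Proof.
  intros p0 q0 s0 (n & l0 & pl & ql & sl) m0 pm qm sm.
  destruct (classic (same_hom p q)) as [pq | pq].
  - apply (line_unique q s); auto.
  - apply (line_unique p q); auto.
Qed.

Lemma same_hom_on_line (l m : hcoord) (X : point) :
  same_hom l m -> on_line X l <-> on_line X m.
Proof.
  destruct l as [[l1 l2] l3]. intros (k & k0 & ->).
  unfold on_line, incident, hom.
  split; intro E.
  - transitivity (k * (l1 * fst X + l2 * snd X + l3 * 1))%R; [ring |].
    rewrite E. ring.
  - apply (Rmult_eq_reg_l k); [| easy]. rewrite Rmult_0_r, <- E. ring.
Qed.

(** The pole condition is evaluated at two points of the polar: the foot of the perpendicular from O
    gives the component of R0 - O along rho, and the foot shifted by i rho shows that the
    perpendicular component vanishes. *)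
Lemma pole_polar (O : point) (r : R) (hr : (0 < r)%R) (rho R0 : point) (l : hcoord) :
  euclidean_line l -> same_hom l (polar O r rho) ->
  is_pole R0 (Circle O r hr) l -> R0 = O + r * rho.
Proof.
  intros El S Pl.
  assert (n0 : (fst rho * fst rho + snd rho * snd rho <> 0)%R).
  { intro Z. destruct l as [[l1 l2] l3], S as (k & k0 & E).
    injection E as E1 E2 _. apply El.
    assert (fst rho = 0%R) by nra. assert (snd rho = 0%R) by nra.
    split; apply (Rmult_eq_reg_l k); lra. }
  assert (on : forall X : point, dot (X - O) rho = r ->
    dot (X - O) (R0 - O) = (r ^ 2)%R).
  { intros X E. apply Pl, (same_hom_on_line _ _ _ S).
    apply incident_polar.
    replace ((fst X, snd X) - 1 * O) with (X - O); [lra |].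
    apply Ceq_coord; simpl; ring. }
  destruct O as [o1 o2], rho as [p1 p2], R0 as [u v]. simpl in n0.
  set (n := (p1 * p1 + p2 * p2)%R) in *.
  assert (E1 : (p1 * (u - o1) + p2 * (v - o2) = r * n)%R).
  { specialize (on (o1 + r * p1 / n, o2 + r * p2 / n)%R).
    unfold dot in on. simpl in on.
    assert (H : ((o1 + r * p1 / n + - o1) * p1 + (o2 + r * p2 / n + - o2) * p2)%R = r).
    { unfold n. field. exact n0. }
    apply on in H. apply (Rmult_eq_reg_l (r / n)).
    - replace (r / n * (r * n))%R with (r * (r * 1))%R by now field.
      rewrite <- H. now field.
    - apply Rmult_integral_contrapositive. split; [lra |].
      now apply Rinv_neq_0_compat. }
  assert (E2 : (p1 * (v - o2) - p2 * (u - o1) = 0)%R).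
  { specialize (on (o1 + r * p1 / n - p2, o2 + r * p2 / n + p1)%R).
    unfold dot in on. simpl in on.
    assert (H : ((o1 + r * p1 / n - p2 + - o1) * p1
      + (o2 + r * p2 / n + p1 + - o2) * p2)%R = r).
    { unfold n. field. exact n0. }
    apply on in H.
    replace (r * (r * 1))%R with (r / n * (r * n))%R in H by now field.
    rewrite <- E1 in H. unfold Rdiv in H. lra. }
  assert (U : (n * (u - o1) = p1 * (p1 * (u - o1) + p2 * (v - o2))
    - p2 * (p1 * (v - o2) - p2 * (u - o1)))%R) by (unfold n; ring).
  assert (V : (n * (v - o2) = p2 * (p1 * (u - o1) + p2 * (v - o2))
    + p1 * (p1 * (v - o2) - p2 * (u - o1)))%R) by (unfold n; ring).
  rewrite E1, E2 in U, V.
  apply Ceq_coord; simpl; apply (Rmult_eq_reg_l n); try easy; lra.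
Qed.

(** * Metric and orientation properties of z |-> u + m conj (z - a) *)

Lemma conj_similarity (u m a : C) :
  m <> 0 -> similarity (fun z => u + m * Cconj (z - a)).
Proof.
  intro m0. exists (Cmod m). split; [now apply Cmod_gt_0 |].
  intros X Y. unfold edist.
  replace (u + m * Cconj (X - a) - (u + m * Cconj (Y - a)))
    with (m * Cconj (X - Y)) by (conj_push; ring).
  now rewrite Cmod_mult, Cmod_conj.
Qed.

Lemma conj_orientation_reversing (u m a : C) :
  m <> 0 -> orientation_reversing (fun z => u + m * Cconj (z - a)).
Proof.
  intros m0 X Y Z. unfold anticlockwise.
  assert (n0 : (0 < fst m * fst m + snd m * snd m)%R).
  { destruct (Req_dec (fst m) 0) as [E | n]; [| nra].
    destruct (Req_dec (snd m) 0) as [F | n]; [| nra].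
    exfalso. now apply m0, Ceq_coord. }
  intro H.
  replace (orient (u + m * Cconj (X - a)) (u + m * Cconj (Z - a))
    (u + m * Cconj (Y - a)))
    with ((fst m * fst m + snd m * snd m) * orient X Y Z)%R.
  - now apply Rmult_lt_0_compat.
  - unfold orient. simpl. ring.
Qed.

(** * Nondegeneracy of the triangle *)

Lemma orient_rot (A B D : point) : orient A B D = orient B D A.
Proof. unfold orient. simpl. ring. Qed.

Lemma side_directions_distinct (A B D : point) (sa sb : C) :
  anticlockwise A B D -> along sa (D - B) -> along sb (A - D) ->
  A <> B /\ sa <> sb.
Proof.
  unfold anticlockwise. intros H Sa Sb. split.
  - intros ->. unfold orient in H. simpl in H. lra.
  - intros <-. rewrite (orient_along sa) in H; [lra | | now apply along_swap].
    apply along_swap. replace (A - B) with ((D - B) + (A - D)) by ring.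
    now apply along_add.
Qed.

(** The point would be A, as common to CA and AB, and also B. This excludes a1 = b1 = c1 and a2 = b2
    = c2 in [miquel_angle_unique]. *)
Lemma sides_no_common_point (A B D X : point) (sa sb sc : C) :
  A <> B -> B <> D -> D <> A ->
  along sa (D - B) -> along sb (A - D) -> along sc (B - A) ->
  sb <> sc -> sc <> sa ->
  on_line X (line_through B D) -> on_line X (line_through D A) ->
  on_line X (line_through A B) -> False.
Proof.
  intros AB BD DA Sa Sb Sc bc ca XA XB XC.
  apply (on_line_along sa) in XA; [| easy | easy].
  apply on_line_sym, (on_line_along sb) in XB;
    [| congruence | now apply along_swap].
  pose proof (proj1 (on_line_along sc _ _ _ AB Sc) XC) as XCA.
  apply on_line_sym, (on_line_along sc) in XC;
    [| congruence | now apply along_swap].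
  apply AB. transitivity X; [symmetry |]; apply Ceq_minus_0.
  - now apply (along_both_0 sb sc).
  - now apply (along_both_0 sc sa).
Qed.

(** * Transfer to the frame X = O + r x, where Gamma is the unit circle *)

Lemma frame_coord (O : C) (r : R) (X : C) :
  r <> 0%R -> exists x : C, X = O + r * x.
Proof.
  intro r0. exists ((X - O) / r). field.
  intro E. now apply r0, RtoC_inj.
Qed.

Lemma frame_along (O : point) (r : R) (s x y : C) :
  r <> 0%R -> along s (O + r * x - (O + r * y)) <-> along s (x - y).
Proof.
  intro r0. replace (O + r * x - (O + r * y)) with (r * (x - y)) by ring.
  now apply along_scale.
Qed.

Lemma frame_parallel (O : point) (r : R) (a x y s : C) :
  r <> 0%R ->
  on_line (O + r * s) (parallel_line (O + r * a) (O + r * x) (O + r * y)) ->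
  (s - a) * Cconj (y - x) = Cconj (s - a) * (y - x).
Proof.
  intros r0 H. unfold parallel_line in H. apply on_line_cross in H.
  assert (r0' : RtoC r <> 0) by (intro E; now apply r0, RtoC_inj).
  apply (Cmult_cancel (r * r)); [now apply Cmult_neq_0 |].
  revert H. conj_push. rewrite RtoC_conj. intro H. lincomb H.
Qed.

Lemma frame_equidistant (O : point) (r : R) (a b k : C) (K : circle) :
  r <> 0%R -> center K = O + r * k ->
  on_circle (O + r * a) K -> on_circle (O + r * b) K ->
  (k - a) * Cconj (k - a) = (k - b) * Cconj (k - b).
Proof.
  intros r0 Ek HA HB. apply on_circle_sqr in HA, HB.
  rewrite Ek in HA, HB. rewrite <- HB in HA.
  assert (r0' : RtoC r <> 0) by (intro E; now apply r0, RtoC_inj).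
  apply (Cmult_cancel (r * r)); [now apply Cmult_neq_0 |].
  revert HA. conj_push. rewrite RtoC_conj. intro H. lincomb H.
Qed.

Lemma apex_frame (O : point) (r : R) (a1 a2 p q t l l' : C) :
  r <> 0%R -> a1 * Cconj a1 = 1 -> a2 * Cconj a2 = 1 -> l * l' = 1 ->
  O + r * p <> O + r * a1 -> O + r * q <> O + r * a2 ->
  along (l * (a1 * a2)) (O + r * p - (O + r * a1)) ->
  along (l' * (a1 * a2)) (O + r * q - (O + r * a2)) ->
  is_intersection (O + r * t) (line_through (O + r * p) (O + r * a1))
    (line_through (O + r * q) (O + r * a2)) ->
  l <> - (1) /\ (1 + l) * t = a1 + l * a2.
Proof.
  intros r0 u1 u2 ll PA QA Pl Ql (NP & TP & TQ).
  assert (l0 : l <> 0).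
  { intro E. apply C1_nz. rewrite <- ll, E. ring. }
  assert (El : l' = / l).
  { apply (Cmult_cancel l); [easy |]. rewrite ll. now field. }
  (* Equal factors would make P A1 and Q A2 parallel. Since l l' = 1, this rules out both l = 1 and
     l = - 1. *)
  assert (self : l' <> l).
  { intro E. apply NP, (parallel_of_along (l * (a1 * a2))); [easy |].
    now rewrite <- E. }
  assert (lm : l <> - (1)).
  { intro E. apply self. apply (Cmult_cancel l); [easy |]. rewrite ll, E. ring. }
  split; [easy |].
  apply on_line_sym in TP, TQ.
  apply (on_line_along (l * (a1 * a2))) in TP; [| congruence | easy].
  apply (on_line_along (l' * (a1 * a2))) in TQ; [| congruence | easy].
  apply frame_along in TP, TQ; try easy.
  rewrite (Cmult_comm a1 a2) in TQ.
  apply along_chord in TP, TQ; try easy.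
  apply (apex_eq l (a1 * a2)); try easy.
  - intro E. apply self. apply (Cmult_cancel l); [easy |]. rewrite ll, E. ring.
  - rewrite <- El, (Cmult_comm a1 a2). exact TQ.
Qed.

(** Shaped for [miquel_angle_unique], with l conj p as the second unknown and - l as the angle
    factor. *)
Lemma miquel_frame (O : point) (r : R) (a1 a2 p l : C) :
  r <> 0%R -> a1 * Cconj a1 = 1 ->
  along (l * (a1 * a2)) (O + r * p - (O + r * a1)) ->
  p + a1 * a2 * (l * Cconj p) = a1 - - l * a2.
Proof.
  intros r0 u1 E. apply frame_along in E; [| easy].
  apply along_chord in E; [| easy]. lincomb E.
Qed.

(** For Q the points a1 and a2 exchange roles; division by l restores the shape of the system for P,
    now with [/ l]. *)
Lemma miquel_frame_inv (O : point) (r : R) (a1 a2 q l : C) :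
  r <> 0%R -> a2 * Cconj a2 = 1 -> l <> 0 ->
  along (l * (a1 * a2)) (O + r * q - (O + r * a2)) ->
  / l * q + a1 * a2 * Cconj q = a1 - - / l * a2.
Proof.
  intros r0 u2 l0 E. rewrite (Cmult_comm a1 a2) in E.
  apply miquel_frame in E; try easy.
  transitivity (/ l * (q + a2 * a1 * (l * Cconj q))); [now field |].
  rewrite E. now field.
Qed.

Theorem proposition4p3
  (A B C : point) (Gamma : circle)
  (A1 A2 B1 B2 C1 C2 P Q TA TB TC : point)
  (A0 B0 C0 l : hcoord) (R0 : point) (K : circle) (St : point) :
  anticlockwise A B C ->
  meets_line_at Gamma B C A1 A2 ->
  meets_line_at Gamma C A B1 B2 ->
  meets_line_at Gamma A B C1 C2 ->
  is_miquel_point P A B C A1 B1 C1 ->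
  is_miquel_point Q A B C A2 B2 C2 ->
  P <> Q ->
  P <> A1 -> P <> B1 -> P <> C1 ->
  Q <> A2 -> Q <> B2 -> Q <> C2 ->
  is_intersection TA (line_through P A1) (line_through Q A2) ->
  is_intersection TB (line_through P B1) (line_through Q B2) ->
  is_intersection TC (line_through P C1) (line_through Q C2) ->
  is_meet A0 (chord Gamma B1 C2) (chord Gamma C1 B2) ->
  is_meet B0 (chord Gamma A1 C2) (chord Gamma C1 A2) ->
  is_meet C0 (chord Gamma A1 B2) (chord Gamma B1 A2) ->
  is_common_line l A0 B0 C0 ->
  euclidean_line l ->
  ~ on_line (center Gamma) l ->
  is_pole R0 Gamma l ->
  is_circumcircle K A B C ->
  TB <> TC -> TC <> TA -> TA <> TB ->
  on_circle St K ->
  on_line St (parallel_line A TB TC) ->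
  on_line St (parallel_line B TC TA) ->
  on_line St (parallel_line C TA TB) ->
  exists f : point -> point,
    similarity f /\ orientation_reversing f /\
    f A = TA /\ f B = TB /\ f C = TC /\
    f St = R0 /\ f (antipode K St) = center Gamma.
Proof.
  destruct Gamma as [O r hr].
  intros ori MA MB MC MP MQ _ PA PB PC QA QB QC IA IB IC
    (_ & A00 & A0l & A0m) (_ & B00 & B0l & B0m) (_ & C00 & C0l & C0m)
    Hl El _ Pl (KA & KB & KC) TBC TCA TAB _ SA SB _.
  assert (r0 : r <> 0%R) by lra.
  assert (r0' : RtoC r <> 0) by (intro E; now apply r0, RtoC_inj).
  pose proof ori as ori1. unfold anticlockwise in ori1.
  pose proof ori1 as ori2. rewrite orient_rot in ori1, ori2.
  rewrite orient_rot in ori2.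
  assert (AB : A <> B).
  { intros ->. unfold orient in ori1. simpl in ori1. lra. }
  assert (BC : B <> C).
  { intros ->. unfold orient in ori1. simpl in ori1. lra. }
  assert (CA : C <> A).
  { intros ->. unfold orient in ori1. simpl in ori1. lra. }
  destruct (frame_coord O r A1 r0) as [a1 ->], (frame_coord O r A2 r0) as [a2 ->],
    (frame_coord O r B1 r0) as [b1 ->], (frame_coord O r B2 r0) as [b2 ->],
    (frame_coord O r C1 r0) as [c1 ->], (frame_coord O r C2 r0) as [c2 ->],
    (frame_coord O r P r0) as [p ->], (frame_coord O r Q r0) as [q ->],
    (frame_coord O r TA r0) as [ta ->], (frame_coord O r TB r0) as [tb ->],
    (frame_coord O r TC r0) as [tc ->].
  destruct (meets_line_along _ _ _ _ _ _ _ BC MA) as (ua1 & ua2 & Sa).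
  destruct (meets_line_along _ _ _ _ _ _ _ CA MB) as (ub1 & ub2 & Sb).
  destruct (meets_line_along _ _ _ _ _ _ _ AB MC) as (uc1 & uc2 & Sc).
  destruct (side_directions_distinct A B C _ _ ori Sa Sb) as [_ sab].
  destruct (side_directions_distinct B C A _ _ ori1 Sb Sc) as [_ sbc].
  destruct (side_directions_distinct C A B _ _ ori2 Sc Sa) as [_ sca].
  assert (unit_mul : forall u v : Complex.C, u * Cconj u = 1 -> v * Cconj v = 1 ->
    u * v * Cconj (u * v) = 1).
  { intros u v U V. conj_push.
    replace (u * v * (Cconj u * Cconj v)) with (u * Cconj u * (v * Cconj v)) by ring.
    rewrite U, V. ring. }
  pose proof (unit_mul _ _ ua1 ua2) as ua.
  pose proof (unit_mul _ _ ub1 ub2) as ub.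
  pose proof (unit_mul _ _ uc1 uc2) as uc.
  destruct (miquel_along _ _ _ _ _ _ _ _ _ _ AB BC CA Sa Sb Sc
    (unit_neq_0 _ ua) (unit_neq_0 _ ub) (unit_neq_0 _ uc) PA PB PC MP)
    as (m & PAm & PBm & PCm).
  destruct (miquel_along _ _ _ _ _ _ _ _ _ _ AB BC CA Sa Sb Sc
    (unit_neq_0 _ ua) (unit_neq_0 _ ub) (unit_neq_0 _ uc) QA QB QC MQ)
    as (m' & QAm & QBm & QCm).
  assert (um : m * Cconj m = 1).
  { apply (along_unit _ _ _ (Cminus_neq_0 _ _ PA) ua PAm). }
  assert (um' : m' * Cconj m' = 1).
  { apply (along_unit _ _ _ (Cminus_neq_0 _ _ QA) ua QAm). }
  pose proof (unit_neq_0 _ um) as m0.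
  pose proof (unit_neq_0 _ um') as m'0.
  pose proof (miquel_frame_inv _ _ _ _ _ _ r0 ua2 m'0 QAm) as EA.
  pose proof (miquel_frame_inv _ _ _ _ _ _ r0 ub2 m'0 QBm) as EB.
  pose proof (miquel_frame_inv _ _ _ _ _ _ r0 uc2 m'0 QCm) as EC.
  (* Both Miquel points give solutions of the same system, with unknowns p, m conj p and q / m',
     conj q. *)
  assert (mm : - m = - / m').
  { apply (miquel_angle_unique a1 a2 b1 b2 c1 c2 p (m * Cconj p) (- m)
      (/ m' * q) (Cconj q)); try easy; try now apply (miquel_frame O r).
    - intros [E F]. destruct MP as (LA & LB & LC & _).
      rewrite <- F, <- E in LC. rewrite <- E in LB.
      now apply (sides_no_common_point A B C (O + r * a1) _ _ _ AB BC CA Sa Sb Sc).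
    - intros [E F]. destruct MQ as (LA & LB & LC & _).
      rewrite <- F, <- E in LC. rewrite <- E in LB.
      now apply (sides_no_common_point A B C (O + r * a2) _ _ _ AB BC CA Sa Sb Sc). }
  assert (Em : / m' = m) by lincomb mm.
  rewrite Em in EA, EB, EC.
  assert (mm' : m * m' = 1) by (rewrite <- Em; now field).
  destruct (apex_frame O r a1 a2 p q ta m m') as [m1 TA']; auto.
  destruct (apex_frame O r b1 b2 p q tb m m') as [_ TB']; auto.
  destruct (apex_frame O r c1 c2 p q tc m m') as [_ TC']; auto.
  (* [la] is the factor l in P - A1 = l s_a conj (P - A1); the sign is the one built into
     [along]. *)
  set (la := - m) in *.
  assert (ul : la * Cconj la = 1).
  { unfold la. conj_push. rewrite <- um. ring. }
  assert (l1 : la <> 1).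
  { intro E. apply m1. unfold la in E. lincomb (Ceq_scale (- (1)) _ _ E). }
  pose proof (Cdistinct_1_minus _ l1) as L0.
  assert (Em' : m = - la) by (unfold la; ring).
  rewrite Em' in EA, EB, EC, TA', TB', TC'.
  assert (EA' : a1 * a2 * Cconj q - la * q = a1 - la * a2) by lincomb EA.
  assert (EB' : b1 * b2 * Cconj q - la * q = b1 - la * b2) by lincomb EB.
  assert (EC' : c1 * c2 * Cconj q - la * q = c1 - la * c2) by lincomb EC.
  set (rho := - (la * q + la * q) / (1 - la)).
  assert (Erho : (1 - la) * rho = - (la * q + la * q)) by (unfold rho; now field).
  assert (ER : R0 = O + r * rho).
  { apply (pole_polar O r hr rho R0 l); [easy | | easy].
    apply (common_line_unique A0 B0 C0); auto.
    - now apply polar_neq_0.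
    - apply (pascal_incident O r hr b1 b2 c1 c2 la q); auto.
    - apply (pascal_incident O r hr a1 a2 c1 c2 la q); auto.
    - apply (pascal_incident O r hr a1 a2 b1 b2 la q); auto. }
  destruct (frame_coord O r (center K) r0) as [k Ek].
  destruct (frame_coord O r A r0) as [a ->], (frame_coord O r B r0) as [b ->],
    (frame_coord O r C r0) as [c ->], (frame_coord O r St r0) as [st ->].
  apply frame_along in Sa, Sb, Sc; try easy.
  assert (frame_neq : forall u v : Complex.C, O + r * u <> O + r * v -> u <> v).
  { intros u v n E. apply n. now rewrite E. }
  destruct (opposite_similarity a b c (a1 * a2) (b1 * b2) (c1 * c2) la q
    ta tb tc rho st k) as (n & n0 & Fb & Fc & Fs & Fo); auto.
  - rewrite EA'. lincomb TA'.
  - rewrite EB'. lincomb TB'.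
  - rewrite EC'. lincomb TC'.
  - now apply (frame_equidistant O r _ _ _ K).
  - now apply (frame_equidistant O r _ _ _ K).
  - now apply (frame_parallel O r).
  - now apply (frame_parallel O r).
  - exists (fun z => O + r * ta + n * Cconj (z - (O + r * a))).
    split; [now apply conj_similarity |].
    split; [now apply conj_orientation_reversing |].
    assert (image : forall u v : Complex.C, v = ta + n * Cconj (u - a) ->
      O + r * ta + n * Cconj (O + r * u - (O + r * a)) = O + r * v).
    { intros u v ->. conj_push. rewrite RtoC_conj. ring. }
    repeat split.
    + rewrite (image a ta); [easy | conj_push; ring].
    + now apply image.
    + now apply image.
    + rewrite ER. now apply image.
    + replace (antipode K (O + r * st)) with (O + r * (k + k - st)).
      * rewrite (image _ 0); [apply Ceq_coord; simpl; ring | now symmetry].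
      * unfold antipode. rewrite Ek.
        replace (RtoC 2) with (1 + 1) by (apply Ceq_coord; simpl; ring).
        apply Ceq_coord; simpl; ring.
Qed.
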